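(* Let $x_1\in\mathbb R$ with $|x_1|\le1$. For any $\alpha\in(0,1]$ and any $0\le\beta<\alpha/2$, $$I_{\alpha,\beta}:=\iiint_{u_1^2+u_2^2+v_2^2<1}\frac{|u_1-x_1|^{-1+\alpha}}{\big(u_1^2+u_2^2+v_2^2\big)^{1+\beta}}\,du_1\,du_2\,dv_2\le A_{\alpha,\beta}<\infty,$$ where the constant $A_{\alpha,\beta}$ is independent of $x_1$. *)

(* Defs.v *)
From HB Require Import structures.
From mathcomp Require Import all_boot all_order all_algebra.
From mathcomp Require Import all_classical all_reals all_analysis.
Set Implicit Arguments. Unset Strict Implicit. Unset Printing Implicit Defensive.
Import Order.TTheory GRing.Theory Num.Theory.
Local Open Scope classical_set_scope.
Local Open Scope ring_scope.

(* Lebesgue measure on R^3, realised as the product measure on (R * R) * R.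
   A point p : (R * R) * R is read as p = ((u1, u2), v2). *)
Definition leb3 (R : realType) :=
  ((@lebesgue_measure R \x @lebesgue_measure R) \x @lebesgue_measure R)%E.

Definition ball3 (R : realType) : set ((R * R) * R) :=
  [set p | p.1.1 ^+ 2 + p.1.2 ^+ 2 + p.2 ^+ 2 < 1].

Definition integrand3 (R : realType) (alpha beta x1 : R) (p : (R * R) * R) : R :=
  `|p.1.1 - x1| `^ (-1 + alpha) /
    (p.1.1 ^+ 2 + p.1.2 ^+ 2 + p.2 ^+ 2) `^ (1 + beta).

Definition I_ab (R : realType) (alpha beta x1 : R) : \bar R :=
  (\int[@leb3 R]_(p in @ball3 R) (integrand3 alpha beta x1 p)%:E)%E.

(* Main.v *)
Require Import Defs.
From HB Require Import structures.
From mathcomp Require Import all_boot all_order all_algebra.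
From mathcomp Require Import all_classical all_reals all_analysis.
From mathcomp Require Import measurable_realfun lra.
Set Implicit Arguments.
Unset Strict Implicit.
Unset Printing Implicit Defensive.

Import Order.TTheory GRing.Theory Num.Theory.
Import numFieldNormedType.Exports.

Local Open Scope ring_scope.
Local Open Scope classical_set_scope.

(* Write S := u1^2 + u2^2 + v2^2 and split 1 + beta = t + g with t, g >= 0.  As S
   exceeds each of its summands, S^(1+beta) >= |u1|^(2t) |u2|^g |v2|^g, and comparing
   with the smaller of the two bases, |u1 - x1|^(alpha-1) |u1|^(-2t) <=
   |u1 - x1|^(-s) + |u1|^(-s) where s = 1 - alpha + 2t.  So the integrand is dominated
   by a product of one-variable powers |u - c|^(-s), |u|^(-g) cut off to [-1, 1], and
   by Tonelli its integral is a product of one-variable integrals.  These are bounded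
   uniformly in |c| <= 1 as soon as s, g < 1 (fundamental theorem of calculus on
   [c + e, c + r] and its mirror image, then monotone convergence as e -> 0), and
   beta < alpha/2 leaves room for a t making both exponents < 1. *)

Lemma ge0_integral_bigcup_nd_le d (T : measurableType d) (R : realType)
    (mu : {measure set T -> \bar R}) (F : (set T)^nat) (f : T -> \bar R)
    (K : \bar R) :
  nondecreasing_seq F -> (forall n, measurable (F n)) ->
  (forall n, measurable_fun (F n) f) -> (forall n x, F n x -> (0 <= f x)%E) ->
  (forall n, \int[mu]_(x in F n) f x <= K)%E ->
  (\int[mu]_(x in \bigcup_n F n) f x <= K)%E.
Proof.
move=> ndF mF mf f0 FK.
have cvgF := @ge0_nondecreasing_set_cvg_integral _ _ _ F f mu ndF mF mf f0.
rewrite -(cvg_lim _ cvgF) //; apply: lime_le; first exact: cvgP cvgF.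
exact: nearW.
Qed.

Section singular_power.
Variable R : realType.
Local Notation mu := (@lebesgue_measure R).
Implicit Types c e r s x : R.

Lemma measurable_powR_dist c s : measurable_fun setT (fun x : R => `|x - c| `^ s).
Proof.
apply: (measurableT_comp (measurable_powR _)).
apply: (@measurableT_comp _ _ _ _ _ _ (@Num.Def.normr _ R)).
  exact: normr_measurable.
by apply: measurable_funB => //; exact: measurable_cst.
Qed.

Lemma continuous_powR_dist c s x : x != c ->
  {for x, continuous (fun y : R => `|y - c| `^ s)}.
Proof.
move=> xc.
have cnorm : {for x, continuous (fun y : R => `|y - c|)}.
  apply: (@continuous_comp _ _ _ (fun y : R => y - c) (@Num.Def.normr _ R)).
    by apply: cvgB; [exact: cvg_id | exact: cvg_cst].
  exact: norm_continuous.
have cpow : {for `|x - c|, continuous (@powR R ^~ s)}.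
  apply: differentiable_continuous; apply/derivable1_diffP.
  by apply: derivable_powR; rewrite in_itv /= andbT normr_gt0 subr_eq0.
exact: (continuous_comp cnorm cpow).
Qed.

Lemma is_derive_powR_dist_primitive c s x : c < x -> s < 1 ->
  is_derive x 1 (fun y : R => (1 - s)^-1 * (y - c) `^ (1 - s)) (`|x - c| `^ (- s)).
Proof.
move=> cx s1; have xc0 : 0 < x - c by rewrite subr_gt0.
have dshift : is_derive x 1 (fun y : R => y - c) 1.
  by apply: is_derive_eq; rewrite subr0.
have dpow := @is_derive1_comp R (@powR R ^~ (1 - s)) (fun y => y - c) x _ _
  (is_derive1_powR (1 - s) xc0) dshift.
apply: is_derive_eq (is_deriveZ (1 - s)^-1 dpow) _.
have s10 : 1 - s != 0 by rewrite subr_eq0 eq_sym lt_eqF.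
rewrite mulr1 /GRing.scale /= mulrA mulVf // mul1r.
by rewrite gtr0_norm // addrAC subrr add0r.
Qed.

Lemma integral_powR_dist_right c e r s : 0 < e -> e < r -> s < 1 ->
  (\int[mu]_(x in `[(c + e)%R, (c + r)%R]) (`|x - c| `^ (- s))%:E =
   ((r `^ (1 - s) - e `^ (1 - s)) / (1 - s))%:E)%E.
Proof.
move=> e0 er s1.
pose F y := (1 - s)^-1 * (y - c) `^ (1 - s).
have dF x : c < x -> is_derive x 1 F (`|x - c| `^ (- s)).
  by move=> cx; exact: is_derive_powR_dist_primitive.
have cF x : c < x -> {for x, continuous F}.
  move=> cx; apply: differentiable_continuous; apply/derivable1_diffP.
  by have [] := dF x cx.
have ce : c < c + e by rewrite ltrDl.
rewrite (@continuous_FTC2 _ _ F).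
- by rewrite -EFinB /F (addrC c r) (addrC c e) !addrK -mulrBr mulrC.
- by rewrite ltrD2l.
- apply: continuous_in_subspaceT => x; rewrite inE /= in_itv /= => /andP[cex _].
  by apply: continuous_powR_dist; rewrite gt_eqF // (lt_le_trans ce cex).
- split.
  + move=> x; rewrite in_itv /= => /andP[cex _].
    by have [] := dF x (lt_trans ce cex).
  + by apply: cvg_at_right_filter; exact: cF.
  + by apply: cvg_at_left_filter; apply: cF; rewrite ltrDl (lt_trans e0 er).
- move=> x; rewrite in_itv /= => /andP[cex _].
  by have [_ dFx] := dF x (lt_trans ce cex); rewrite derive1E dFx.
Qed.

Lemma integral_powR_dist_left c e r s : 0 < e -> e < r -> s < 1 ->
  (\int[mu]_(x in `[(c - r)%R, (c - e)%R]) (`|x - c| `^ (- s))%:E =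
   ((r `^ (1 - s) - e `^ (1 - s)) / (1 - s))%:E)%E.
Proof.
move=> e0 er s1.
rewrite -(@integral_powR_dist_right (- c) _ _ _ e0 er s1) -[c]opprK -!opprD.
rewrite integration_by_substitution_oppr; first last.
- apply: continuous_in_subspaceT => x; rewrite inE /= in_itv /= => /andP[_ xce].
  apply: continuous_powR_dist; rewrite lt_eqF //; apply: le_lt_trans xce _.
  by rewrite opprD opprK ltrBlDr ltrDl.
- by rewrite lerD2l ltW.
rewrite !opprK; apply: eq_integral => x _ /=.
by rewrite -opprD normrN.
Qed.

Definition annulus c e r : set R := `[c - r, c - e] `|` `[c + e, c + r].

Lemma annulusE c e r : 0 < e -> annulus c e r = [set x | e <= `|x - c| <= r].
Proof.
move=> e0; apply/seteqP; split => x; rewrite /annulus /= !in_itv /=.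
- have [xc|cx] := ltP x c; [rewrite ltr0_norm ?subr_lt0 // | rewrite ger0_norm ?subr_ge0 //];
    by move=> [/andP[h1 h2]|/andP[h1 h2]]; apply/andP; split; lra.
- have [xc|cx] := ltP x c; [rewrite ltr0_norm ?subr_lt0 // | rewrite ger0_norm ?subr_ge0 //];
    move=> /andP[h1 h2]; [left | right]; apply/andP; split; lra.
Qed.

Lemma integral_powR_dist_annulus c e r s : 0 < e -> e < r -> s < 1 ->
  (\int[mu]_(x in annulus c e r) (`|x - c| `^ (- s))%:E =
   (2 * ((r `^ (1 - s) - e `^ (1 - s)) / (1 - s)))%:E)%E.
Proof.
move=> e0 er s1; rewrite ge0_integral_setU //.
- by rewrite integral_powR_dist_left // integral_powR_dist_right // -EFinD mulr_natl mulr2n.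
- by apply/measurable_funTS/measurable_EFinP; exact: measurable_powR_dist.
- apply/disj_setPS => x [] /=; rewrite !in_itv /= => /andP[_ xce] /andP[cex _].
  lra.
Qed.

Lemma bigcup_annulus c r : 0 < r ->
  \bigcup_n annulus c (r / n.+2%:R) r = `[c - r, c + r] `\ c.
Proof.
move=> r0; apply/seteqP; split => x.
- move=> [n _]; rewrite annulusE ?divr_gt0 ?ltr0n //= => /andP[ex xr].
  split; last by move=> xc; move: ex; rewrite xc subrr normr0 leNgt divr_gt0 ?ltr0n.
  by rewrite in_itv /= -ler_distlC distrC.
- rewrite /= in_itv /= -ler_distlC distrC => -[xr /eqP xc].
  have xc0 : 0 < `|x - c| by rewrite normr_gt0 subr_eq0.
  exists (Num.trunc (r / `|x - c|)) => //; rewrite annulusE ?divr_gt0 ?ltr0n //=.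
  rewrite xr andbT ler_pdivrMr ?ltr0n // -ler_pdivrMl // mulrC.
  by apply/ltW/(lt_le_trans (truncnS_gt _)); rewrite ler_nat.
Qed.

Lemma integral_powR_dist_le c r s : 0 < r -> s < 1 ->
  (\int[mu]_(x in `[(c - r)%R, (c + r)%R]) (`|x - c| `^ (- s))%:E <=
   (2 * (r `^ (1 - s) / (1 - s)))%:E)%E.
Proof.
move=> r0 s1.
have mf D : measurable_fun D (fun x => (`|x - c| `^ (- s))%:E).
  by apply/measurable_funTS/measurable_EFinP; exact: measurable_powR_dist.
have e_gt0 n : 0 < r / n.+2%:R by rewrite divr_gt0 ?ltr0n.
rewrite -(@integral_setD1 _ _ c) //; last exact: measurableD.
rewrite -bigcup_annulus //; apply: ge0_integral_bigcup_nd_le => //.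
- move=> m n mn; apply/subsetPset; rewrite !annulusE //= => x /andP[ex xr].
  rewrite /= xr andbT (le_trans _ ex) // ler_pM2l // lef_pV2 ?posrE ?ltr0n //.
  by rewrite ler_nat ltnS.
- by move=> n; apply: measurableU; exact: measurable_itv.
- by move=> n; exact: mf.
- move=> n; rewrite integral_powR_dist_annulus //; last first.
    by rewrite ltr_pdivrMr ?ltr0n // ltr_pMr // ltr1n.
  rewrite lee_fin ler_pM2l // ler_pM2r ?invr_gt0 ?subr_gt0 //.
  by rewrite gerBl powR_ge0.
Qed.

End singular_power.

Section product_measure.
Context d1 d2 (T1 : measurableType d1) (T2 : measurableType d2) (R : realType).
Local Open Scope ereal_scope.

Lemma product_measure1_sigma_finite (m1 : {sigma_finite_measure set T1 -> \bar R})
    (m2 : {sigma_finite_measure set T2 -> \bar R}) :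
  sigma_finite setT (m1 \x m2).
Proof.
have /sigma_finiteP[F [TF ndF Foo]] := sigma_finiteT m1.
have /sigma_finiteP[G [TG ndG Goo]] := sigma_finiteT m2.
exists (fun n => F n `*` G n).
  rewrite -setXTT TF TG predeqE => -[x y]; split.
    move=> [/= [n _ Fnx] [k _ Gky]]; exists (maxn n k) => //; split.
    - by move: x Fnx; exact/subsetPset/ndF/leq_maxl.
    - by move: y Gky; exact/subsetPset/ndG/leq_maxr.
  by move=> [n _ []/= ? ?]; split; exists n.
move=> k; have [? ?] := Foo k; have [? ?] := Goo k.
split; first exact: measurableX.
by rewrite product_measure1E // lte_mul_pinfty // ge0_fin_numE.
Qed.

Lemma integral_product_measure1_mul (m1 : {sigma_finite_measure set T1 -> \bar R})
    (m2 : {sigma_finite_measure set T2 -> \bar R}) (g : T1 -> R) (h : T2 -> R) :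
  measurable_fun setT g -> measurable_fun setT h ->
  (forall x, (0 <= g x)%R) -> (forall y, (0 <= h y)%R) ->
  \int[m1 \x m2]_z (g z.1 * h z.2)%:E = \int[m1]_x (g x)%:E * \int[m2]_y (h y)%:E.
Proof.
move=> mg mh g0 h0.
rewrite (fubini_tonelli1 (fun z => (g z.1 * h z.2)%:E)) /fubini_F /=; last 2 first.
- apply/measurable_EFinP; apply: measurable_funM.
  + exact: measurableT_comp mg measurable_fst.
  + exact: measurableT_comp mh measurable_snd.
- by move=> z; rewrite lee_fin mulr_ge0.
transitivity (\int[m1]_x ((g x)%:E * \int[m2]_y (h y)%:E)).
  apply: eq_integral => x _; rewrite -ge0_integralZl_EFin //.
  - by move=> y _; rewrite lee_fin.
  - exact/measurable_EFinP.
rewrite ge0_integralZr //; first exact/measurable_EFinP.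
- by move=> x _; rewrite lee_fin.
- by apply: integral_ge0 => y _; rewrite lee_fin.
Qed.

Variables (m1 : {measure set T1 -> \bar R}) (m2 : {sigma_finite_measure set T2 -> \bar R}).

Lemma ae_product_measure1_fst (P : T1 -> Prop) :
  {ae m1, forall x, P x} -> {ae m1 \x m2, forall z, P z.1}.
Proof.
case=> N [mN N0 PN]; exists (N `*` setT); split.
- exact: measurableX.
- by rewrite product_measure1E // N0 mul0e.
- by move=> z /= nPz; split => //; exact: PN.
Qed.

Lemma ae_product_measure1_snd (P : T2 -> Prop) :
  {ae m2, forall y, P y} -> {ae m1 \x m2, forall z, P z.2}.
Proof.
case=> N [mN N0 PN]; exists (setT `*` N); split.
- exact: measurableX.
- by rewrite product_measure1E // N0 mule0.
- by move=> z /= nPz; split => //; exact: PN.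
Qed.

End product_measure.

(* The library's sigma-finite instance for [m1 \x m2] is shadowed by the one
   for products of subprobabilities, so planar Lebesgue measure gets its own. *)
Definition leb2 (R : realType) := (@lebesgue_measure R \x @lebesgue_measure R)%E.
HB.instance Definition _ (R : realType) := Measure.on (@leb2 R).
HB.instance Definition _ (R : realType) := Measure_isSigmaFinite.Build _ _ _ (@leb2 R)
  (product_measure1_sigma_finite (@lebesgue_measure R) (@lebesgue_measure R)).

Section pointwise_bound.
Variable R : realType.
Implicit Types a b p q r t g x y z S : R.

Lemma ge0_ger_powRN a b r : 0 <= r -> 0 < a -> a <= b -> b `^ (- r) <= a `^ (- r).
Proof.
move=> r0 a0 ab; have b0 := lt_le_trans a0 ab.
rewrite !powRN lef_pV2 ?posrE ?powR_gt0 //.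
by apply: (ge0_ler_powR r0) => //; rewrite nnegrE ltW.
Qed.

Lemma powRN_mul_le_add a b p q : 0 < a -> 0 < b -> 0 <= p -> 0 <= q ->
  a `^ (- p) * b `^ (- q) <= a `^ (- (p + q)) + b `^ (- (p + q)).
Proof.
move=> a0 b0 p0 q0; wlog ab : a b p q a0 b0 p0 q0 / a <= b.
  move=> wlog; have [|ba] := leP a b; first exact: wlog.
  by rewrite mulrC addrC (addrC p); apply: wlog => //; exact: ltW.
apply: (@le_trans _ _ (a `^ (- (p + q)))); last by rewrite lerDl powR_ge0.
rewrite opprD powRD ?(gt_eqF a0) ?implybT //.
by apply: ler_wpM2l; [exact: powR_ge0 | exact: ge0_ger_powRN].
Qed.

Lemma powR_sqr_le x S r : 0 <= r -> x ^+ 2 <= S -> `|x| `^ r <= S `^ (r / 2).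
Proof.
move=> r0 xS; have {1}-> : r = 2 * (r / 2) by rewrite mulrC divfK ?pnatr_eq0.
rewrite powRrM.
rewrite powR_mulrn // real_normK ?num_real //.
by apply: ge0_ler_powR; rewrite ?nnegrE ?divr_ge0 ?sqr_ge0 // (le_trans (sqr_ge0 x)).
Qed.

Lemma powR_norm3_le_sumsq x y z t g : x != 0 -> 0 <= t -> 0 <= g ->
  `|x| `^ (2 * t) * `|y| `^ g * `|z| `^ g <= (x ^+ 2 + y ^+ 2 + z ^+ 2) `^ (t + g).
Proof.
move=> x0 t0 g0; set S := x ^+ 2 + y ^+ 2 + z ^+ 2.
have x2 : 0 < x ^+ 2 by rewrite exprn_even_gt0.
have [y2 z2] := (sqr_ge0 y, sqr_ge0 z).
have S0 : 0 < S by rewrite /S; lra.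
have -> : t + g = 2 * t / 2 + g / 2 + g / 2 by lra.
rewrite !powRD ?(gt_eqF S0) ?implybT //.
apply: ler_pM; rewrite ?mulr_ge0 ?powR_ge0 //; first apply: ler_pM; rewrite ?powR_ge0 //;
  by apply: powR_sqr_le; rewrite ?mulr_ge0 // /S; lra.
Qed.
Lemma integrand3_le alpha beta x1 t g (p : (R * R) * R) :
  alpha <= 1 -> 0 <= t -> 0 <= g -> t + g = 1 + beta ->
  p.1.1 != 0 -> p.1.1 != x1 -> p.1.2 != 0 -> p.2 != 0 ->
  integrand3 alpha beta x1 p <=
  (`|p.1.1 - x1| `^ (- (1 - alpha + 2 * t)) + `|p.1.1| `^ (- (1 - alpha + 2 * t))) *
  `|p.1.2| `^ (- g) * `|p.2| `^ (- g).
Proof.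
case: p => [[u1 u2] v2] /= a1 t0 g0 tg u10 u1x u20 v20.
have [d0 a0 b0 c0] : [/\ 0 < `|u1 - x1|, 0 < `|u1|, 0 < `|u2| & 0 < `|v2|].
  by rewrite !normr_gt0 subr_eq0.
have S0 : 0 < u1 ^+ 2 + u2 ^+ 2 + v2 ^+ 2.
  by rewrite -addrA ltr_pwDl ?exprn_even_gt0 // addr_ge0 ?sqr_ge0.
rewrite /integrand3 /= -tg (_ : -1 + alpha = - (1 - alpha)); last by rewrite opprB addrC.
apply: (@le_trans _ _ (`|u1 - x1| `^ (- (1 - alpha)) *
    (`|u1| `^ (- (2 * t)) * `|u2| `^ (- g) * `|v2| `^ (- g)))).
  apply: ler_wpM2l; first exact: powR_ge0.
  rewrite !powRN -!invfM lef_pV2 ?posrE ?mulr_gt0 ?powR_gt0 //.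
  exact: powR_norm3_le_sumsq.
rewrite !mulrA; do 2 (apply: ler_wpM2r; first exact: powR_ge0).
by apply: powRN_mul_le_add; rewrite // ?subr_ge0 ?mulr_ge0.
Qed.

End pointwise_bound.

Section domination.
Variable R : realType.
Local Notation mu := (@lebesgue_measure R).
Implicit Types c s g u : R.

Definition cutoff_powR_dist c s : R -> R := (fun u => `|u - c| `^ (- s)) \_ `[-1, 1].

Lemma measurable_cutoff_powR_dist c s : measurable_fun setT (cutoff_powR_dist c s).
Proof.
apply/(measurable_restrictT _ _).1; first exact: measurable_itv.
by apply: measurable_funTS; exact: measurable_powR_dist.
Qed.

Lemma cutoff_powR_dist_ge0 c s u : 0 <= cutoff_powR_dist c s u.
Proof. by rewrite /cutoff_powR_dist patchE; case: ifP => // _; exact: powR_ge0. Qed.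

Lemma cutoff_powR_distE c s u : u ^+ 2 <= 1 -> cutoff_powR_dist c s u = `|u - c| `^ (- s).
Proof.
move=> u1; rewrite /cutoff_powR_dist patchE mem_set //= in_itv /=.
by apply/andP; split; nra.
Qed.

Lemma integral_cutoff_powR_dist_le c s : `|c| <= 1 -> s < 1 ->
  (\int[mu]_u (cutoff_powR_dist c s u)%:E <= (2 * (2 `^ (1 - s) / (1 - s)))%:E)%E.
Proof.
rewrite ler_norml => /andP[c1 c2] s1.
have mf : measurable_fun setT (fun x : R => (`|x - c| `^ (- s))%:E).
  by apply/measurable_EFinP; exact: measurable_powR_dist.
have -> : (\int[mu]_u (cutoff_powR_dist c s u)%:E =
    \int[mu]_(x in `[(-1)%R, 1%R]) (`|x - c| `^ (- s))%:E)%E.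
  by rewrite [RHS]integral_mkcond; apply: eq_integral => x _; rewrite restrict_EFin.
apply: le_trans (@integral_powR_dist_le R c 2 s _ s1) => //.
apply: ge0_subset_integral => //; first exact: measurable_funTS.
by move=> x /=; rewrite !in_itv /= => /andP[x1 x2]; apply/andP; split; lra.
Qed.

Local Notation T3 := ((measurableTypeR R * measurableTypeR R) * measurableTypeR R)%type.

Lemma ae_lebesgue_neq (a : R) : {ae mu, forall x, x != a}.
Proof.
exists [set a]; split => //; first exact: lebesgue_measure_set1.
by move=> x /= /negP; rewrite negbK => /eqP.
Qed.

Lemma integral_leb3_mul3 (f g h : R -> R) :
  measurable_fun setT f -> measurable_fun setT g -> measurable_fun setT h ->
  (forall x, 0 <= f x) -> (forall x, 0 <= g x) -> (forall x, 0 <= h x) ->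
  (\int[@leb3 R]_p (f p.1.1 * g p.1.2 * h p.2)%:E =
   \int[mu]_x (f x)%:E * \int[mu]_x (g x)%:E * \int[mu]_x (h x)%:E)%E.
Proof.
move=> mf mg mh f0 g0 h0.
have mfg : measurable_fun setT (fun w : measurableTypeR R * measurableTypeR R => f w.1 * g w.2).
  by apply: measurable_funM; exact: measurableT_comp.
rewrite (@integral_product_measure1_mul _ _ _ _ _ (@leb2 R) mu (fun w => f w.1 * g w.2) h) //.
  by rewrite integral_product_measure1_mul.
by move=> w; rewrite mulr_ge0.
Qed.

Lemma measurable_sumsq3 :
  measurable_fun setT (fun p : T3 => p.1.1 ^+ 2 + p.1.2 ^+ 2 + p.2 ^+ 2).
Proof.
by apply: measurable_funD; first apply: measurable_funD;
  apply: measurable_funX; do ?apply: measurableT_comp.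
Qed.

Lemma measurable_ball3 : measurable (@ball3 R : set T3).
Proof.
have := @measurable_sumsq3 measurableT _ (measurable_itv `]-oo, 1[%R); rewrite setTI.
by congr measurable; apply/seteqP; split => p; rewrite /ball3 /= in_itv.
Qed.

Lemma measurable_integrand3 alpha beta x1 :
  measurable_fun setT (integrand3 alpha beta x1 : T3 -> R).
Proof.
have -> : integrand3 alpha beta x1 =
    ((fun u => `|u - x1| `^ (-1 + alpha)) \o (fun p : T3 => p.1.1))
    \* (@powR R ^~ (- (1 + beta)) \o (fun p : T3 => p.1.1 ^+ 2 + p.1.2 ^+ 2 + p.2 ^+ 2)).
  by apply: funext => p; rewrite /integrand3 /= powRN.
apply: measurable_funM; apply: measurableT_comp.
- exact: measurable_powR_dist.
- exact: measurableT_comp.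
- exact: measurable_powR.
- exact: measurable_sumsq3.
Qed.

Definition dominant3 (x1 s g : R) (p : T3) : R :=
  (cutoff_powR_dist x1 s p.1.1 + cutoff_powR_dist 0 s p.1.1) *
  cutoff_powR_dist 0 g p.1.2 * cutoff_powR_dist 0 g p.2.

Lemma dominant3_ge0 (x1 s g : R) p : 0 <= dominant3 x1 s g p.
Proof. by rewrite /dominant3 !mulr_ge0 ?addr_ge0 ?cutoff_powR_dist_ge0. Qed.

Lemma measurable_dominant3 (x1 s g : R) : measurable_fun setT (dominant3 x1 s g).
Proof.
have m11 : measurable_fun setT (fun p : T3 => p.1.1) by exact: measurableT_comp.
have m12 : measurable_fun setT (fun p : T3 => p.1.2) by exact: measurableT_comp.
have m2 : measurable_fun setT (fun p : T3 => p.2) by exact: measurable_snd.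
apply: measurable_funM; first apply: measurable_funM.
- by apply: measurable_funD; exact: measurableT_comp (measurable_cutoff_powR_dist _ _) m11.
- exact: measurableT_comp (measurable_cutoff_powR_dist _ _) m12.
- exact: measurableT_comp (measurable_cutoff_powR_dist _ _) m2.
Qed.

Lemma integral_dominant3_le (x1 s g : R) : `|x1| <= 1 -> s < 1 -> g < 1 ->
  (\int[@leb3 R]_p (dominant3 x1 s g p)%:E <=
   ((2 * (2 `^ (1 - s) / (1 - s)) + 2 * (2 `^ (1 - s) / (1 - s))) *
    (2 * (2 `^ (1 - g) / (1 - g))) * (2 * (2 `^ (1 - g) / (1 - g))))%:E)%E.
Proof.
move=> x1le s1 g1; have le01 : `|0 : R| <= 1 by rewrite normr0.
have mc (c r : R) := measurable_cutoff_powR_dist c r.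
have c_ge0 (c r : R) := cutoff_powR_dist_ge0 c r.
rewrite /dominant3 (@integral_leb3_mul3
  (fun u => cutoff_powR_dist x1 s u + cutoff_powR_dist 0 s u)) //; last 2 first.
- by apply: measurable_funD; exact: mc.
- by move=> u; rewrite addr_ge0.
under eq_integral do rewrite EFinD.
rewrite ge0_integralD //; last 4 first.
- by move=> u _; rewrite lee_fin.
- by apply/measurable_EFinP; exact: mc.
- by move=> u _; rewrite lee_fin.
- by apply/measurable_EFinP; exact: mc.
have I0 (c r : R) : (0 <= \int[mu]_x (cutoff_powR_dist c r x)%:E)%E.
  by apply: integral_ge0 => x _; rewrite lee_fin.
rewrite EFinM EFinM EFinD.
have Ib := integral_cutoff_powR_dist_le.
apply: lee_pmul; [exact: mule_ge0 (adde_ge0 (I0 _ _) (I0 _ _)) (I0 _ _) | exact: I0 | | exact: Ib].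
apply: lee_pmul; [exact: adde_ge0 | exact: I0 | | exact: Ib].
by apply: leeD; exact: Ib.
Qed.

#[local] Instance leb3_ae_filter : Filter (almost_everywhere (@leb3 R)) :=
  ae_filter_ringOfSetsType _.

Section bound_on_ball.
Variables (alpha beta x1 t g : R).
Hypotheses (a1 : alpha <= 1) (t0 : 0 <= t) (g0 : 0 <= g) (tg : t + g = 1 + beta).

Lemma ae_integrand3_le_dominant3 : {ae @leb3 R, forall p, ball3 p ->
  integrand3 alpha beta x1 p <= dominant3 x1 (1 - alpha + 2 * t) g p}.
Proof.
have ae11 a : {ae @leb3 R, forall p : T3, p.1.1 != a}.
  exact: ae_product_measure1_fst _ (ae_product_measure1_fst _ (ae_lebesgue_neq a)).
have ae12 : {ae @leb3 R, forall p : T3, p.1.2 != 0}.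
  exact: ae_product_measure1_fst _ (ae_product_measure1_snd _ (ae_lebesgue_neq 0)).
have ae2 : {ae @leb3 R, forall p : T3, p.2 != 0}.
  exact: ae_product_measure1_snd _ (ae_lebesgue_neq 0).
(* The bound holds off the hyperplanes u1 = 0, u1 = x1, u2 = 0, v2 = 0, where
   the junk value [0 `^ (- g) = 0] of the dominating factors would break it. *)
near=> p => pball.
move: (sqr_ge0 p.1.1) (sqr_ge0 p.1.2) (sqr_ge0 p.2) => s11 s12 s2.
rewrite /dominant3 !cutoff_powR_distE ?subr0; try by rewrite /ball3 /= in pball; lra.
apply: integrand3_le => //.
- by near: p; exact: ae11.
- by near: p; exact: ae11.
- by near: p; exact: ae12.
- by near: p; exact: ae2.
Unshelve. all: by end_near.
Qed.

Lemma I_ab_le_integral_dominant3 :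
  (I_ab alpha beta x1 <= \int[@leb3 R]_p (dominant3 x1 (1 - alpha + 2 * t) g p)%:E)%E.
Proof.
have mdom : measurable_fun setT (fun p => (dominant3 x1 (1 - alpha + 2 * t) g p)%:E).
  by apply/measurable_EFinP; exact: measurable_dominant3.
apply: (@le_trans _ _
  (\int[@leb3 R]_(p in @ball3 R) (dominant3 x1 (1 - alpha + 2 * t) g p)%:E)%E).
  apply: ae_ge0_le_integral.
  - exact: measurable_ball3.
  - by move=> p _; rewrite lee_fin /integrand3 divr_ge0 ?powR_ge0.
  - by apply/measurable_funTS/measurable_EFinP; exact: measurable_integrand3.
  - by move=> p _; rewrite lee_fin dominant3_ge0.
  - exact: measurable_funTS.
  - by apply: filterS ae_integrand3_le_dominant3 => p le_p /le_p; rewrite lee_fin.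
apply: ge0_subset_integral => //; first exact: measurable_ball3.
by move=> p _; rewrite lee_fin dominant3_ge0.
Qed.

End bound_on_ball.

End domination.

Theorem lemma3p2 (R : realType) (alpha beta : R) :
  0 < alpha -> alpha <= 1 -> 0 <= beta -> beta < alpha / 2 ->
  exists A : R, forall x1 : R, `|x1| <= 1 -> (I_ab alpha beta x1 <= A%:E)%E.
Proof.
move=> a0 a1 b0 ba.
pose t := beta / 2 + alpha / 4; pose g := 1 + beta - t; pose s := 1 - alpha + 2 * t.
(* That is, s = 1 - alpha/2 + beta and g = 1 + beta/2 - alpha/4, both < 1. *)
have t0 : 0 <= t by rewrite /t; lra.
have g0 : 0 <= g by rewrite /g /t; lra.
have tg : t + g = 1 + beta by rewrite /g; lra.
have s1 : s < 1 by rewrite /s /t; lra.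
have g1 : g < 1 by rewrite /g /t; lra.
pose K (r : R) := 2 * (2 `^ (1 - r) / (1 - r)).
exists ((K s + K s) * K g * K g) => x1 x1le.
apply: le_trans (I_ab_le_integral_dominant3 x1 a1 t0 g0 tg) _.
exact: integral_dominant3_le.
Qed.
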